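(* Let $(P,\Pi,h_z)$ be the homogeneous Poisson manifold given by the Poissonization of a Jacobi manifold $(J,\Lambda,E)$, let $\alpha,\beta:\mathcal U\subset T^*P\to P$ be the maps of a homogeneous symplectic bi-realization of $P$, and let $\hat H\in C^\infty(P)$ be a $1$-homogeneous Hamiltonian, i.e. $\hat H\circ h_z=z\hat H$ for all $z\in\mathbb R^\times$. Define smooth functions $S_1,S_2,\dots$ on $P$ recursively by $S_1=\hat H$ and, for $i\ge 1$, $$S_{i+1}(p)=\frac{1}{(i+1)!}\left.\frac{d^i}{ds^i}\right|_{s=0}\hat H\left(\alpha\left(d_pS^{(i)}_s\right)\right),\qquad S^{(i)}_s=\sum_{j=1}^i s^jS_j,\qquad p\in P.$$ Then every $S_i$, $i\ge1$, is $1$-homogeneous: $S_i\circ h_z=z\,S_i$ for all $z\in\mathbb R^\times$.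
   Context: A Jacobi manifold $(J,\Lambda,E)$ is a smooth manifold $J$ with a bivector field $\Lambda$ and a vector field $E$ such that $[\Lambda,\Lambda]=2E\wedge\Lambda$ and $[E,\Lambda]=0$ (Schouten brackets). Its Poissonization is $P=J\times\mathbb R^\times$, $\mathbb R^\times=\mathbb R\setminus\{0\}$, with points $(x,t)$, Poisson bivector $\Pi=\frac1t\Lambda+\frac{\partial}{\partial t}\wedge E$, and the action of $z\in\mathbb R^\times$ given by $h_z(x,t)=(x,zt)$. The action is lifted to $T^*P$ by $T^*h_z(x,t,\xi_x,\xi_t)=(x,zt,z\xi_x,\xi_t)$, where $\xi_x,\xi_t$ are the components of a covector along $J$ and along $\mathbb R^\times$. A homogeneous symplectic bi-realization of $P$ consists of an open neighbourhood $\mathcal U\subset T^*P$ of the zero section, invariant under all $T^*h_z$, carrying a symplectic form, and two smooth surjective submersions $\alpha,\beta:\mathcal U\to P$, which restrict to the identity on the zero section (identified with $P$), one of them a Poisson map and the other an anti-Poisson map, with symplectically orthogonal fibres, satisfying the homogeneity conditions $h_z\circ\alpha=\alpha\circ T^*h_z$ and $h_z\circ\beta=\beta\circ T^*h_z$ for all $z\in\mathbb R^\times$. For a function $S$ on $P$, $d_pS\in T_p^*P$ denotes its differential at $p$ (with respect to all coordinates, including $t$). For each $p$, the covector $d_pS^{(i)}_s$ vanishes at $s=0$, so it lies in $\mathcal U$ for $|s|$ small and the derivative at $s=0$ makes sense. *)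

(* Defs.v *)
From HB Require Import structures.
From mathcomp Require Import all_boot all_order all_algebra.
From mathcomp Require Import all_classical all_reals all_analysis.

Set Implicit Arguments.
Unset Strict Implicit.
Unset Printing Implicit Defensive.
Import Order.TTheory GRing.Theory Num.Theory.
Import numFieldNormedType.Exports.
Local Open Scope classical_set_scope.
Local Open Scope ring_scope.

(* Vectors and covectors are both row vectors; a covector xi pairs with a
   vector v as xi *m v^T, and 'J f x acts on vectors from the right.  A bivector
   is the antisymmetric matrix B with B(xi, eta) = xi *m B *m eta^T, a 2-form
   the antisymmetric matrix W with W(v, w) = v *m W *m w^T. *)

Section Euclidean.
Context {R : realType} {n : nat}.
Implicit Types W : normedModType R.

Definition iter_derive W (f : 'rV[R]_n -> W) (vs : seq 'rV[R]_n) : 'rV[R]_n -> W :=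
  foldr (fun v g => fun y => 'D_v g y) f vs.

(* C^infty on a set A, meant for A open: all iterated directional derivatives
   exist and are continuous at every point of A. *)
Definition smooth_on W (A : set 'rV[R]_n) (f : 'rV[R]_n -> W) : Prop :=
  forall (vs : seq 'rV[R]_n) (y : 'rV[R]_n), A y ->
    (forall v, derivable (iter_derive f vs) y v) /\
    {for y, continuous (iter_derive f vs)}.

Definition partial (l : 'I_n) (f : 'rV[R]_n -> R^o) (y : 'rV[R]_n) : R :=
  'D_(delta_mx 0 l) f y.

(* Coordinate expressions of the Schouten brackets, normalised by
   (1/2)[A, A](df, dg, dh) = {{f, g}, h} + cyclic,  {f, g} = A(df, dg), and
   [X, A] = Lie derivative of A along X. *)
Definition schouten22 (A B : 'rV[R]_n -> 'M[R]_n) (y : 'rV[R]_n)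
    (i j k : 'I_n) : R :=
  let cyc (C D : 'rV[R]_n -> 'M[R]_n) :=
    \sum_l (C y l k * partial l (fun x => D x i j) y
          + C y l i * partial l (fun x => D x j k) y
          + C y l j * partial l (fun x => D x k i) y) in
  cyc A B + cyc B A.

Definition schouten12 (X : 'rV[R]_n -> 'rV[R]_n) (A : 'rV[R]_n -> 'M[R]_n)
    (y : 'rV[R]_n) (i j : 'I_n) : R :=
  \sum_l (X y 0 l * partial l (fun x => A x i j) y
        - A y l j * partial l (fun x => X x 0 i) y
        - A y i l * partial l (fun x => X x 0 j) y).

Definition wedge12 (X : 'rV[R]_n) (A : 'M[R]_n) (i j k : 'I_n) : R :=
  X 0 i * A j k + X 0 j * A k i + X 0 k * A i j.

Definition exterior_d2 (w : 'rV[R]_n -> 'M[R]_n) (y : 'rV[R]_n)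
    (i j k : 'I_n) : R :=
  partial i (fun x => w x j k) y + partial j (fun x => w x k i) y
  + partial k (fun x => w x i j) y.

Definition antisym (B : 'M[R]_n) : Prop := B^T = - B.

End Euclidean.

(* cinv is only meaningful on the image of cdom. *)
Record chart (R : realType) (n : nat) (M : Type) := Chart {
  cdom : set M;
  cmap : M -> 'rV[R]_n;
  cinv : 'rV[R]_n -> M }.

(* chart_at selects a chart around each point; the tangent and cotangent spaces
   at x are identified with 'rV[R]_n through chart_at x. *)
Record charted (R : realType) (n : nat) := Charted {
  pts :> Type;
  atlas : set (chart R n pts);
  chart_at : pts -> chart R n pts }.

Section Charted.
Context {R : realType} {n : nat}.
Implicit Types M : charted R n.

Definition chart_open M (A : set M) : Prop :=
  forall c, atlas c -> open (cmap c @` (cdom c `&` A)).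

Record is_manifold M : Prop := IsManifold {
  chart_at_atlas : forall x : M, atlas (chart_at x) /\ cdom (chart_at x) x;
  chart_cancel : forall c : chart R n M, atlas c ->
    forall x, cdom c x -> cinv c (cmap c x) = x;
  chart_dom_open : forall c : chart R n M, atlas c -> chart_open (cdom c);
  chart_transition : forall c c' : chart R n M, atlas c -> atlas c' ->
    smooth_on (cmap c @` (cdom c `&` cdom c')) (cmap c' \o cinv c);
  manifold_hausdorff : forall x y : M, x <> y ->
    exists A B : set M, [/\ chart_open A, chart_open B, A x, B y & A `&` B = set0];
  manifold_second_countable : exists B : nat -> set M,
    (forall k, chart_open (B k)) /\
    (forall (A : set M) x, chart_open A -> A x -> exists2 k, B k x & B k `<=` A) }.

(* Jacobian at x of the change of coordinates from c to c'. *)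
Definition transition M (c c' : chart R n M) (x : M) : 'M[R]_n :=
  'J (cmap c' \o cinv c) (cmap c x).

Definition vector_in M (c : chart R n M) (X : M -> 'rV[R]_n) (y : 'rV[R]_n)
    : 'rV[R]_n :=
  let x := cinv c y in X x *m transition (chart_at x) c x.

Definition bivector_in M (c : chart R n M) (B : M -> 'M[R]_n) (y : 'rV[R]_n)
    : 'M[R]_n :=
  let x := cinv c y in let T := transition (chart_at x) c x in T^T *m B x *m T.

Definition form2_in M (c : chart R n M) (w : M -> 'M[R]_n) (y : 'rV[R]_n)
    : 'M[R]_n :=
  let x := cinv c y in let T := transition c (chart_at x) x in T *m w x *m T^T.

Definition smooth_fun M (f : M -> R) : Prop :=
  forall c : chart R n M, atlas c ->
    smooth_on (cmap c @` cdom c) (f \o cinv c : 'rV[R]_n -> R^o).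

Definition vector_field M (X : M -> 'rV[R]_n) : Prop :=
  forall c : chart R n M, atlas c -> smooth_on (cmap c @` cdom c) (vector_in c X).

Definition bivector_field M (B : M -> 'M[R]_n) : Prop :=
  (forall x, antisym (B x)) /\
  (forall c : chart R n M, atlas c ->
     smooth_on (cmap c @` cdom c) (bivector_in c B)).

Definition symplectic_form_on M (U : set M) (w : M -> 'M[R]_n) : Prop :=
  (forall x, U x -> antisym (w x) /\ w x \in unitmx) /\
  (forall c : chart R n M, atlas c ->
     smooth_on (cmap c @` (cdom c `&` U)) (form2_in c w) /\
     (forall y, (cmap c @` (cdom c `&` U)) y ->
        forall i j k, exterior_d2 (form2_in c w) y i j k = 0)).

(* Poisson bivector of w : B(df, dg) = w(X_f, X_g) where w(X_f, _) = df. *)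
Definition symplectic_bivector (w : 'M[R]_n) : 'M[R]_n := (invmx w)^T.

Definition differential M (f : M -> R) (x : M) : 'rV[R]_n :=
  \row_j partial j (f \o cinv (chart_at x)) (cmap (chart_at x) x).

End Charted.

Section Maps.
Context {R : realType} {m n : nat} {M : charted R m} {N : charted R n}.
Implicit Types f : M -> N.

Definition tangent_map f (x : M) : 'M[R]_(m, n) :=
  'J (cmap (chart_at (f x)) \o f \o cinv (chart_at x)) (cmap (chart_at x) x).

Definition smooth_map_on (U : set M) f : Prop :=
  forall (c : chart R m M) (c' : chart R n N), atlas c -> atlas c' ->
    let D := cmap c @` (cdom c `&` U `&` f @^-1` cdom c') in
    open D /\ smooth_on D (cmap c' \o f \o cinv c).

Definition submersion_on (U : set M) f : Prop :=
  smooth_map_on U f /\ (forall x, U x -> row_full (tangent_map f x)).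

(* f relates the bivector field B on U to s times the bivector field C:
   Poisson for s = 1, anti-Poisson for s = -1. *)
Definition poisson_on (s : R) (U : set M) (B : M -> 'M[R]_m) (C : N -> 'M[R]_n) f
    : Prop :=
  forall x, U x ->
    (tangent_map f x)^T *m B x *m tangent_map f x = s *: C (f x).

End Maps.

Section Constructions.
Context {R : realType}.

Definition prod_chart m n (M N : Type) (c : chart R m M) (d : chart R n N)
    : chart R (m + n) (M * N) :=
  Chart (cdom c `*` cdom d) (fun p => row_mx (cmap c p.1) (cmap d p.2))
        (fun v => (cinv c (lsubmx v), cinv d (rsubmx v))).

Definition prod_charted m n (M : charted R m) (N : charted R n)
    : charted R (m + n) :=
  @Charted R (m + n) (M * N)%type
    [set e | exists c d, [/\ atlas c, atlas d & e = prod_chart c d]]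
    (fun p => prod_chart (chart_at p.1) (chart_at p.2)).

Definition cotangent_chart n (M : charted R n) (c : chart R n M)
    : chart R (n + n) (M * 'rV[R]_n) :=
  Chart [set u | cdom c u.1]
        (fun u => row_mx (cmap c u.1)
                         (u.2 *m (transition c (chart_at u.1) u.1)^T))
        (fun v => let x := cinv c (lsubmx v) in
                  (x, rsubmx v *m (transition (chart_at x) c x)^T)).

Definition cotangent n (M : charted R n) : charted R (n + n) :=
  @Charted R (n + n) (M * 'rV[R]_n)%type
    [set e | exists2 c, atlas c & e = cotangent_chart c]
    (fun u => cotangent_chart (chart_at u.1)).

Definition Rx : Type := {t : R | t != 0}.

Definition Rx_one : Rx := exist _ 1 (oner_neq0 R).

Definition Rx_mul (z t : Rx) : Rx :=
  exist _ (val z * val t) (mulf_neq0 (valP z) (valP t)).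

Definition Rx_chart : chart R 1 Rx :=
  Chart setT (fun t => const_mx (val t)) (fun v => insubd Rx_one (v 0 0)).

Definition Rx_charted : charted R 1 :=
  @Charted R 1 Rx [set Rx_chart] (fun=> Rx_chart).

End Constructions.
Arguments Rx R : clear implicits.
Arguments Rx_charted R : clear implicits.

Record jacobi_manifold (R : realType) (n : nat) := JacobiManifold {
  jman :> charted R n;
  jman_manifold : is_manifold jman;
  jLambda : jman -> 'M[R]_n;
  jE : jman -> 'rV[R]_n;
  jLambda_bivector : bivector_field jLambda;
  jE_vector : vector_field jE;
  jLambda_Lambda : forall c : chart R n jman, atlas c ->
    forall y, (cmap c @` cdom c) y -> forall i j k,
      schouten22 (bivector_in c jLambda) (bivector_in c jLambda) y i j k =
      2 * wedge12 (vector_in c jE y) (bivector_in c jLambda y) i j k;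
  jE_Lambda : forall c : chart R n jman, atlas c ->
    forall y, (cmap c @` cdom c) y -> forall i j,
      schouten12 (vector_in c jE) (bivector_in c jLambda) y i j = 0 }.

Section Poissonization.
Context {R : realType} {n : nat} (J : jacobi_manifold R n).

Definition poissonization : charted R (n + 1) := prod_charted J (Rx_charted R).

(* (1/t) Lambda + d/dt /\ E, where X /\ Y = X (x) Y - Y (x) X. *)
Definition poisson_bivector (p : poissonization) : 'M[R]_(n + 1) :=
  block_mx ((val p.2)^-1 *: jLambda p.1) (- (jE p.1)^T)
           (jE p.1)                      0.

Definition dilation (z : Rx R) (p : poissonization) : poissonization :=
  (p.1, Rx_mul z p.2).

Definition cotangent_dilation (z : Rx R) (u : cotangent poissonization)
    : cotangent poissonization :=
  (dilation z u.1, row_mx (val z *: lsubmx u.2) (rsubmx u.2)).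

Definition homogeneous1 (f : poissonization -> R) : Prop :=
  forall (z : Rx R) p, f (dilation z p) = val z * f p.

Definition cot_differential (f : poissonization -> R) (p : poissonization)
    : cotangent poissonization :=
  (p, differential f p).

(* src and tgt are the maps alpha and beta; only their values on bdom matter. *)
Record homogeneous_birealization := HomogeneousBirealization {
  bdom : set (cotangent poissonization);
  bform : cotangent poissonization -> 'M[R]_((n + 1) + (n + 1));
  src : cotangent poissonization -> poissonization;
  tgt : cotangent poissonization -> poissonization;
  bdom_open : chart_open bdom;
  bdom_zero : forall p : poissonization, bdom (p, 0);
  bdom_invariant : forall z, cotangent_dilation z @` bdom `<=` bdom;
  bform_symplectic : symplectic_form_on bdom bform;
  src_submersion : submersion_on bdom src;
  tgt_submersion : submersion_on bdom tgt;
  src_surjective : src @` bdom = setT;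
  tgt_surjective : tgt @` bdom = setT;
  src_zero : forall p : poissonization, src (p, 0) = p;
  tgt_zero : forall p : poissonization, tgt (p, 0) = p;
  src_tgt_poisson :
    let B := fun u => symplectic_bivector (bform u) in
    (poisson_on 1 bdom B poisson_bivector src /\
     poisson_on (-1) bdom B poisson_bivector tgt) \/
    (poisson_on (-1) bdom B poisson_bivector src /\
     poisson_on 1 bdom B poisson_bivector tgt);
  src_tgt_orthogonal : forall u, bdom u ->
    forall v : 'rV[R]_((n + 1) + (n + 1)),
    v *m tangent_map tgt u = 0 <->
    (forall w : 'rV[R]_((n + 1) + (n + 1)),
       w *m tangent_map src u = 0 -> v *m bform u *m w^T = 0);
  src_homogeneous : forall z u, bdom u ->
    dilation z (src u) = src (cotangent_dilation z u);
  tgt_homogeneous : forall z u, bdom u ->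
    dilation z (tgt u) = tgt (cotangent_dilation z u) }.

(* H o alpha on the domain of the bi-realization.  The value 0 elsewhere is
   immaterial: the domain is open and only germs at its points are used. *)
Definition comp_src (B : homogeneous_birealization) (H : poissonization -> R)
    : cotangent poissonization -> R^o :=
  patch (fun=> 0) (bdom B) (H \o src B).

Definition partial_sum (S : nat -> poissonization -> R) (i : nat) (s : R)
    (p : poissonization) : R :=
  \sum_(1 <= j < i.+1) s ^+ j * S j p.

End Poissonization.

(* Main.v *)
Require Import Defs.
From HB Require Import structures.
From mathcomp Require Import all_boot all_order all_algebra.
From mathcomp Require Import all_classical all_reals all_analysis.

Set Implicit Arguments.
Unset Strict Implicit.
Unset Printing Implicit Defensive.
Import Order.TTheory GRing.Theory Num.Theory.
Import numFieldNormedType.Exports.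
Local Open Scope classical_set_scope.
Local Open Scope ring_scope.

(* A 1-homogeneous f satisfies d_{h_z p} f = T^*h_z (d_p f): scaling the values
   by z is compensated in the t-direction by scaling the argument.  By induction
   S^{(i)}_s is 1-homogeneous, so homogeneity of alpha and H makes
   H (alpha (d_p S^{(i)}_s)) 1-homogeneous in p for every s, and s-derivatives
   preserve this. *)

(* No convergence is assumed: a divergent filter on [R^o] has the junk limit 0,
   which scaling preserves. *)
Lemma lim_scale_neq0 (R : realType) (T : Type) (F : set_system T)
    (FF : ProperFilter F) (k : R) (f : T -> R^o) :
  k != 0 -> lim (k *: f x @[x --> F]) = k * lim (f x @[x --> F]).
Proof.
move=> k0; have [cf|ncf] := pselect (cvg (f x @[x --> F])).
  exact: limZl_tmp.
rewrite [in RHS]dvgP // mulr0 dvgP //.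
by have := is_cvgZlE f k0 => E; rewrite -E in ncf.
Qed.

(** Justifies the substitution of [k * h] for [h] in a difference quotient. One inclusion is
    continuity of multiplication by [k] at 0, the other that of multiplication by [k^-1]. *)
Lemma dnbhs0_scale (R : realType) (k : R) :
  k != 0 -> (fun h : R => k * h) @ 0^' = 0^'.
Proof.
move=> k0.
have sub (c : R) (A : set R) : c != 0 -> 0^' A -> 0^' [set h | A (c * h)].
  move=> c0 A0; have /(_ _ A0) : c * h @[h --> (0 : R)] --> (0 : R).
    by rewrite -[X in _ --> X](mulr0 c); exact: mulrl_continuous.
  apply: (@filterS _ (nbhs (0 : R))) => h /= Ach h0.
  by apply: Ach; rewrite mulf_neq0.
apply/seteqP; split=> A; last exact: sub.
have kV0 : k^-1 != 0 by rewrite invr_eq0.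
by move=> /(sub _ _ kV0); apply: filterS => h /=; rewrite mulVKf.
Qed.

Section Derive.
Context {R : realType} {V : normedModType R}.
Implicit Types (f : V -> R^o) (k : R).

Lemma derive_scale_neq0 f k (x v : V) : k != 0 ->
  'D_v (fun y => k * f y : R^o) x = k * 'D_v f x.
Proof.
move=> k0; rewrite /derive -lim_scale_neq0//; congr (lim _).
apply: (congr1 (fun g => g @ 0^')); apply/funext => h /=.
by rewrite -mulrBr; exact: mulrCA.
Qed.

Lemma derive_dir_scale_neq0 f k (x v : V) : k != 0 ->
  'D_(k *: v) f x = k * 'D_v f x.
Proof.
move=> k0; rewrite /derive -lim_scale_neq0//.
rewrite -[in RHS](dnbhs0_scale k0); congr (lim _).
rewrite -fmap_comp; apply: (congr1 (fun g => g @ 0^')); apply/funext => h /=.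
by rewrite invfM !scalerA mulrA divff// mul1r (mulrC h).
Qed.

End Derive.

Lemma derive1n_scale_neq0 (R : realType) (k : R) (f : R -> R^o) i :
  k != 0 -> derive1n i (fun s => k * f s : R^o) = fun s => k * derive1n i f s.
Proof.
move=> k0; elim: i => [//|i IH]; rewrite !derive1nS IH; apply/funext => s.
by rewrite !derive1E derive_scale_neq0.
Qed.

(** Linearity makes the two difference quotients the same function of [h], so their limits agree
    even when they are default values. *)
Lemma derive_linear_comp (R : realType) (V W X : normedModType R)
    (L : {linear V -> W}) (f : W -> X) (x v : V) :
  'D_v (f \o L) x = 'D_(L v) f (L x).
Proof.
rewrite /derive; congr (lim _); apply: (congr1 (fun g => g @ 0^')).
by apply/funext => h /=; rewrite linearP.
Qed.

Section Homogeneity.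
Context {R : realType} {n : nat} (J : jacobi_manifold R n).

(** In a chart, [h_z] is the linear map [L = diag(1, z)] and homogeneity reads [F \o L = z F].
    Differentiating along [v] gives ['D_(L v) F (L y) = z * 'D_v F y], which is then read off on
    basis vectors. *)
Lemma homogeneous1_cot_differential (f : poissonization J -> R) (z : Rx R) p :
  homogeneous1 f ->
  cot_differential f (dilation z p) = cotangent_dilation z (cot_differential f p).
Proof.
move=> fh; case: p => x t; congr pair.
have z0 : val z != 0 := valP z.
pose F (v : 'rV[R]_(n + 1)) : R^o :=
  f (cinv (chart_at x) (lsubmx v), insubd Rx_one (rsubmx v 0 0)).
pose coords (s : Rx R) :=
  row_mx (cmap (chart_at x) x) (const_mx (val s) : 'rV_1).
(* The chart chosen at [(x, s)] depends on [x] only, so the differentials at [p] and at [h_z p] are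
   taken in the same chart. *)
have dfE s : differential f ((x, s) : poissonization J) =
  \row_j partial j F (coords s) by [].
rewrite !dfE.
pose L : {linear 'rV[R]_(n + 1) -> 'rV[R]_(n + 1)} :=
  mulmxr (block_mx 1%:M 0 0 (val z)%:M).
have LE a b : L (row_mx a b) = row_mx a (val z *: b).
  by rewrite /L /= mul_row_block !mulmx0 mulmx1 addr0 add0r mul_mx_scalar.
set y := coords t.
have coordsM : coords (Rx_mul z t) = L y.
  by rewrite LE; congr row_mx; apply/matrixP => i j; rewrite !mxE.
have scaleF v : 'D_(L v) F (L y) = val z * 'D_v F y.
  rewrite -derive_linear_comp -derive_scale_neq0//; apply: near_eq_derive.
  (* [F \o L = z F] may fail where the t-coordinate is 0, as [insubd] returns [Rx_one] there; near
     [y] that coordinate is nonzero. *)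
  have : \forall a \near y, (a : 'rV[R]_(n + 1)) 0 (rshift n ord0) != 0.
    have yt0 : y 0 (rshift n ord0) != 0 by rewrite row_mxEr mxE (valP t).
    have cy : {for y, continuous (fun a : 'rV[R]_(n + 1) => a 0 (rshift n ord0))}.
      exact: coord_continuous.
    exact: (cvgr_neq0 _ cy yt0).
  apply: filterS => a a0.
  rewrite [LHS]/comp -[in LHS](hsubmxK a) LE /F row_mxKl row_mxKr -fh.
  congr (f (_, _)); apply: val_inj => /=.
  have {}a0 : rsubmx a 0 0 != 0 by rewrite mxE.
  by rewrite !val_insubd mxE mulf_neq0// a0.
apply/rowP => j; rewrite coordsM; case: (split_ordP j) => k ->.
  (* [L] fixes the directions along [J], so these components pick up the factor [z]. *)
  rewrite row_mxEl !mxE /partial -scaleF; congr ('D_ _ F _).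
  rewrite -[delta_mx _ _]hsubmxK LE; congr row_mx.
  by apply/rowP => i; rewrite !mxE eq_rlshift mulr0.
rewrite row_mxEr !mxE /partial.
(* [L] multiplies the t-direction by [z], which cancels the factor [z] of [scaleF]. *)
apply: (mulfI z0); rewrite -scaleF -derive_dir_scale_neq0//; congr ('D_ _ F _).
rewrite -[delta_mx _ _]hsubmxK LE scale_row_mx; congr row_mx.
by apply/rowP => i; rewrite !mxE eq_lrshift mulr0.
Qed.

(** The inverse is the dilation by [z^-1]. It upgrades the inclusion [bdom_invariant] to an
    equivalence. *)
Lemma cotangent_dilationK (z : Rx R) : exists w : Rx R,
  cancel (@cotangent_dilation R n J z) (cotangent_dilation w).
Proof.
have z0 : val z != 0 := valP z.
exists (exist (fun t : R => t != 0) _ (invr_neq0 z0)) => -[[x t] xi].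
rewrite /cotangent_dilation /dilation /=; congr (_, _, _).
  by apply: val_inj => /=; rewrite mulKf.
by rewrite row_mxKl row_mxKr scalerA mulVf// scale1r hsubmxK.
Qed.

Lemma comp_src_dilation (B : homogeneous_birealization J) H (z : Rx R) u :
  homogeneous1 H ->
  comp_src B H (cotangent_dilation z u) = val z * comp_src B H u.
Proof.
move=> Hh; rewrite /comp_src /patch.
have [w zK] := cotangent_dilationK z.
(* Both sides must fall in the same branch of [patch]; off the domain both are 0. *)
have -> : (cotangent_dilation z u \in bdom B) = (u \in bdom B).
  apply/idP/idP; rewrite !inE => Bu.
    rewrite -(zK u); apply: (bdom_invariant (z := w)).
    by exists (cotangent_dilation z u).
  by apply: (bdom_invariant (z := z)); exists u.
case: ifPn => [|_]; last by rewrite mulr0.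
by rewrite inE => Bu /=; rewrite -src_homogeneous// Hh.
Qed.

Lemma homogeneous1_partial_sum (S : nat -> poissonization J -> R) i s :
  (forall j, (1 <= j <= i)%N -> homogeneous1 (S j)) ->
  homogeneous1 (partial_sum S i s).
Proof.
move=> Sh z p; rewrite /partial_sum mulr_sumr big_nat [RHS]big_nat.
by apply: eq_bigr => j ji; rewrite Sh// mulrCA.
Qed.

End Homogeneity.

Theorem theorem2p1 (R : realType) (n : nat) (J : jacobi_manifold R n)
    (B : homogeneous_birealization J) (H : poissonization J -> R)
    (Hsmooth : smooth_fun H) (Hhom : homogeneous1 H)
    (S : nat -> poissonization J -> R)
    (S1 : S 1%N = H)
    (Srec : forall (i : nat) (p : poissonization J), (1 <= i)%N ->
       S i.+1 p = (i.+1)`!%:R^-1 *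
         derive1n i (fun s : R =>
           comp_src B H (cot_differential (partial_sum S i s) p)) 0) :
  forall i : nat, (1 <= i)%N -> homogeneous1 (S i).
Proof.
(* Strong induction, since the partial sum in the recursion involves all earlier terms. *)
elim/ltn_ind => -[//|[_ _|i IH _]]; first by rewrite S1.
move=> z p; rewrite !Srec// mulrCA; congr (_ * _).
(* Moving [z] inside the s-derivative reduces the claim to an identity for each fixed [s]. *)
rewrite -[RHS](congr1 (fun g => g 0) (derive1n_scale_neq0 _ _ (valP z))).
congr (derive1n _ _ 0); apply/funext => s.
rewrite homogeneous1_cot_differential ?comp_src_dilation//.
by apply: homogeneous1_partial_sum => j /andP[j1 ji]; exact: IH.
Qed.
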